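(* Let $0<\lambda<1$, $T(x)=2x\pmod 1$ and $A(x)=-(x-1/2)^2$. Denote by $b:S^1\to\mathbb{R}$ the function such that for $0\le x\le 1/2$ we have $b(x)=S(x,(10)^\infty)$, and for $1/2\le x\le 1$ we have $b(x)=S(x,(01)^\infty)$. Then $b$ is a $\lambda$-calibrated subaction for $A$, that is, for any $x\in S^1$, $$b(x)=\max_{i=0,1}\{\lambda b(\tau_ix)+A(\tau_ix)\}=\max\{\lambda b(x/2)+A(x/2),\ \lambda b(x/2+1/2)+A(x/2+1/2)\}.$$ Moreover, $$b(0)=\frac{2\lambda}{4(4-\lambda)(2+\lambda)(\lambda-1)},$$ and this provides the explicit expression of $b$.
   Context: $S^1$ is $[0,1]$ with $0$ and $1$ identified. The inverse branches of $T$ are $\tau_0(x)=x/2$ and $\tau_1(x)=(x+1)/2$ on $[0,1]$. For $a=(a_0,a_1,\dots)\in\{0,1\}^{\mathbb{N}}$, put $\tau_{k,a}=\tau_{a_k}\circ\cdots\circ\tau_{a_0}$ and $S(x,a)=\sum_{k\ge0}\lambda^kA(\tau_{k,a}x)$ for $x\in[0,1]$. Here $(10)^\infty=(1,0,1,0,\dots)$ and $(01)^\infty=(0,1,0,1,\dots)$. A $\lambda$-calibrated subaction for $A$ is a continuous function $b$ on $S^1$ with $b(x)=\max_{T(y)=x}\{\lambda b(y)+A(y)\}$ for all $x\in S^1$.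
   Formalization: The printed value of b(0) is false for every 0<λ<1 (the series begins −λ/16−λ²/64, the printed formula −λ/16−3λ²/64); the formal statement has numerator 2λ−λ² in place of 2λ. *)

(* Defs.v *)
From HB Require Import structures.
From mathcomp Require Import all_boot all_order all_algebra.
From mathcomp Require Import generic_quotient.
From mathcomp Require Import all_classical all_reals all_analysis.
Import Order.TTheory GRing.Theory Num.Theory.
Import numFieldNormedType.Exports.

Set Implicit Arguments.
Unset Strict Implicit.
Unset Printing Implicit Defensive.

Local Open Scope classical_set_scope.
Local Open Scope ring_scope.

(* S^1 is the topological quotient of [0, 1] by the relation identifying the
   endpoints. *)
Section Circle.
Local Open Scope quotient_scope.
Variable R : realType.

Definition unit_itv := set_type `[0 : R, 1]%classic.
HB.instance Definition _ := Topological.on unit_itv.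
HB.instance Definition _ := SubType.on unit_itv.

Definition is_endpoint (x : unit_itv) : bool :=
  (val x == 0 :> R) || (val x == 1 :> R).

Definition glue (x y : unit_itv) : bool :=
  (x == y) || (is_endpoint x && is_endpoint y).

Lemma glue_refl : reflexive glue.
Proof. by move=> x; rewrite /glue eqxx. Qed.

Lemma glue_sym : symmetric glue.
Proof. by move=> x y; rewrite /glue eq_sym andbC. Qed.

Lemma glue_trans : transitive glue.
Proof.
move=> y x z /orP[/eqP-> //|/andP[ex ey]] /orP[/eqP<-|/andP[_ ez]].
  by rewrite /glue ex ey orbT.
by rewrite /glue ex ez orbT.
Qed.

Definition glue_rel := EquivRel glue glue_refl glue_sym glue_trans.

Definition circle := {eq_quot glue_rel}.
HB.instance Definition _ := Topological.copy circle (quotient_topology circle).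
HB.instance Definition _ := Quotient.on circle.

Definition frac (x : R) : R := x - (Num.floor x)%:~R.

Lemma frac_unit_itv (x : R) : frac x \in `[0 : R, 1]%classic.
Proof.
apply/mem_set; rewrite /= in_itv /= /frac subr_ge0 ge_floor /=.
by rewrite lerBlDl -intrD1 ltW // floorD1_gt.
Qed.

(* The class of x mod 1, for every real x. Since frac fixes [0, 1[ and maps 1
   to 0, on [0, 1] this is the quotient map, see circ_pi. *)
Definition circ (x : R) : circle := \pi_circle (SigSub (frac_unit_itv x)).

Lemma circ_pi (x : unit_itv) : circ (val x) = \pi_circle x.
Proof.
apply/eqmodP; rewrite /= /glue /is_endpoint /=.
have /set_mem := valP x; rewrite /= in_itv /= => /andP[x0].
rewrite le_eqVlt => /orP[/eqP x1|x1].
  have f0 : frac (sval x) = 0 by rewrite x1 /frac floor1 subrr.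
  by apply/orP; right; apply/andP; split; rewrite ?f0 ?x1 eqxx ?orbT.
apply/orP; left; apply/eqP/val_inj; rewrite /= /frac.
by rewrite (floor_def (m := 0)) ?x0 ?add0r // subr0.
Qed.

(* f induces a function on the circle when f 0 = f 1, see circ_lift_circ. *)
Definition circ_lift (V : Type) (f : R -> V) (q : circle) : V :=
  f (val (repr q)).

Lemma circ_lift_circ (V : Type) (f : R -> V) (x : R) :
  f 0 = f 1 -> 0 <= x -> x <= 1 -> circ_lift f (circ x) = f x.
Proof.
move=> f01 x0 x1.
have xI : x \in `[0 : R, 1]%classic by apply/mem_set; rewrite /= in_itv /= x0.
pose u : unit_itv := SigSub xI.
rewrite (_ : circ x = \pi_circle u); last exact: (circ_pi u).
rewrite /circ_lift; case: piP => v /eqmodP/orP[/eqP <- //|/andP[]].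
by rewrite /is_endpoint /= => /orP[]/eqP-> /orP[]/eqP->.
Qed.

End Circle.

Arguments circ {R} x.

Section Discounted.
Variable R : realType.
Implicit Types (x lambda : R) (a : nat -> bool).

Definition doubling : circle R -> circle R := circ_lift (fun x => circ (2 * x)).

Lemma doubling_circ x : 0 <= x -> x <= 1 -> doubling (circ x) = circ (2 * x).
Proof.
move=> x0 x1; rewrite /doubling circ_lift_circ // /circ; congr (\pi_(_) _)%qT.
apply/val_inj; rewrite /= mulr0 mulr1 /frac floor0 subrr.
by rewrite -[X in X - _]/(2%:~R) -[X in Num.floor X]/(2%:~R) intrKfloor subrr.
Qed.

Definition potential x : R := - (x - 1 / 2) ^+ 2.

(* The two inverse branches x / 2 and (x + 1) / 2; the symbols 0 and 1 of
   sequences are encoded by false and true. *)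
Definition tau (i : bool) x : R := (x + i%:R) / 2.

Fixpoint tau_iter (k : nat) a x : R :=
  if k is k'.+1 then tau (a k) (tau_iter k' a x) else tau (a 0%N) x.

Definition Ssum lambda x a : R :=
  limn (series (fun k => lambda ^+ k * potential (tau_iter k a x))).

Definition seq10 : nat -> bool := fun n => ~~ odd n.

Definition seq01 : nat -> bool := odd.

Definition is_maximum (E : set R) (m : R) := E m /\ ubound E m.

Definition calibrated_subaction lambda (A b : circle R -> R) :=
  continuous b /\
  forall q, is_maximum [set lambda * b p + A p | p in [set p | doubling p = q]]
                       (b q).

Definition is_candidate lambda (b : circle R -> R) :=
  (forall x, 0 <= x <= 1 / 2 -> b (circ x) = Ssum lambda x seq10) /\
  (forall x, 1 / 2 <= x <= 1 -> b (circ x) = Ssum lambda x seq01).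

End Discounted.

(* Main.v *)
(* Let F be the quadratic polynomial of the explicit expression on [0, 1/2],
   and put F_1(x) = F(x), F_0(x) = F(1 - x).  The constants are exactly those
   for which F_i(x) = A(tau_i x) + lambda F_{1-i}(tau_i x).  Iterating this
   identity along an alternating sequence telescopes, so F_1 and F_0 are the
   two discounted sums.  Moreover F_1(x) >= F_0(x) iff x <= 1/2, so
   b = max(F_1, F_0) on [0, 1], and the same identity, read at x with i = 0, 1,
   is the calibration equation. *)
Require Import Defs.
From mathcomp Require Import all_boot all_order all_algebra.
From mathcomp Require Import all_classical all_reals all_analysis.
From mathcomp Require Import ring lra.
Import Order.TTheory GRing.Theory Num.Theory.
Import numFieldNormedType.Exports.

Local Open Scope classical_set_scope.
Local Open Scope ring_scope.

(** * Points and continuous maps of the circle, fibres of the doubling map *)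

Section Circle.
Set Implicit Arguments.
Unset Strict Implicit.
Variable R : realType.
Local Notation frac := Defs.frac.
Implicit Types x y : R.

Lemma circ_frac x y : frac x = frac y -> circ x = circ y.
Proof. by move=> xy; rewrite /circ; congr (\pi_(_) _)%qT; apply/val_inj. Qed.

Lemma frac_ge0_lt1 x : 0 <= frac x < 1.
Proof.
have /andP[] := floor_itv x; rewrite /frac intrD => ? ?.
by apply/andP; split; lra.
Qed.

Lemma frac_id x : 0 <= x < 1 -> frac x = x.
Proof. by move=> x01; rewrite /frac (floor_def (m := 0)) ?add0r // subr0. Qed.

Lemma fracDn x n : frac (x + n%:R) = frac x.
Proof.
rewrite /frac floorDrz ?natr_int // -[n%:R]/(n%:~R) intrKfloor intrD.
by rewrite opprD addrACA subrr addr0.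
Qed.

(** Since [frac] never takes the value 1, two glued endpoints of this form are both 0. *)
Lemma eq_circ x y : circ x = circ y -> frac x = frac y.
Proof.
move=> /eqmodP/orP[/eqP[]//|]; rewrite /is_endpoint /=.
have /andP[_ /lt_eqF->] := frac_ge0_lt1 x.
have /andP[_ /lt_eqF->] := frac_ge0_lt1 y.
by rewrite !orbF => /andP[/eqP-> /eqP->].
Qed.

Lemma circDn x n : circ (x + n%:R) = circ x.
Proof. exact/circ_frac/fracDn. Qed.

Lemma circP (q : circle R) : exists2 x, 0 <= x < 1 & q = circ x.
Proof.
exists (frac (val (repr q))); first exact: frac_ge0_lt1.
rewrite -[LHS]reprK -(circ_pi (repr q)); apply/circ_frac.
by rewrite [RHS]frac_id // frac_ge0_lt1.
Qed.

(** By the universal property of the quotient topology it suffices to compose with the projection,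
    which gives back [f] on the unit interval. *)
Lemma circ_lift_continuous (V : topologicalType) (f : R -> V) :
  f 0 = f 1 -> continuous f -> continuous (circ_lift f).
Proof.
move=> f01 cf; apply/quotient_continuous.
rewrite (_ : _ \o _ = f \o val).
  by move=> u; apply: continuous_comp; [exact: initial_continuous | exact: cf].
apply/funext => u /=; rewrite -circ_pi.
have /set_mem := valP u; rewrite /= in_itv /= => /andP[u0 u1].
exact: circ_lift_circ.
Qed.

Lemma doubling_preimage x :
  0 <= x < 1 ->
  [set p | doubling p = circ x] =
  [set circ (tau false x); circ (tau true x)].
Proof.
move=> /andP[x0 x1]; apply/seteqP; split=> p /=; last first.
  have tE i : doubling (circ (tau i x)) = circ x.
    rewrite doubling_circ; first last.
    - by rewrite /tau; case: i => /=; lra.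
    - by rewrite /tau; case: i => /=; lra.
    by rewrite -[RHS](circDn x i) /tau mulrC divfK.
  by case=> ->.
have [y /andP[y0 y1] ->] := circP p.
rewrite doubling_circ ?(ltW y1) // => /eq_circ.
rewrite (frac_id (x := x)) ?x0 // => xE.
have [y2|y2] := ltP y (1 / 2).
  left; congr circ; move: xE; rewrite frac_id /tau /=; first by lra.
  by apply/andP; split; lra.
right; congr circ; move: xE.
(* Here [2 * y] lies in [1, 2), so its fractional part is [2 * y - 1]. *)
rewrite (_ : 2 * y = (2 * y - 1) + 1%:R); last by rewrite subrK.
rewrite fracDn frac_id /tau /=; first by lra.
by apply/andP; split; lra.
Qed.

End Circle.

(** * Closed form of the discounted sums along alternating sequences *)

Section Discounted.
Set Implicit Arguments.
Unset Strict Implicit.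
Variables (R : realType) (lambda : R).
Hypotheses (hl0 : 0 < lambda) (hl1 : lambda < 1).
Implicit Types x y : R.

Lemma tau_itv (i : bool) x : 0 <= x <= 1 -> 0 <= tau i x <= 1.
Proof.
by move=> /andP[x0 x1]; rewrite /tau; case: i => /=; apply/andP; split; lra.
Qed.

(** [V n] stands for the discounted sum along [a] shifted by [n]. Unrolling its recursion [n] times
    leaves a remainder of size at most [lambda ^+ n * M], which tends to 0. *)
Lemma Ssum_telescope (a : nat -> bool) (V : nat -> R -> R) (M : R) x :
    (forall n y, V n y = potential (tau (a n) y) +
                         lambda * V n.+1 (tau (a n) y)) ->
    (forall n y, 0 <= y <= 1 -> `|V n y| <= M) ->
  0 <= x <= 1 -> Ssum lambda x a = V 0%N x.
Proof.
move=> VE VM x01.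
(* [tau_iter k] already applies [k + 1] branches; [t] shifts the index so that the orbit starts at
   [x]. *)
pose t n := if n is m.+1 then tau_iter m a x else x.
have tE n : t n.+1 = tau (a n) (t n) by case: n.
have t01 n : 0 <= t n <= 1.
  by elim: n => [//|n IH]; rewrite tE tau_itv.
have partial n :
    series (fun k => lambda ^+ k * potential (tau_iter k a x)) n =
    V 0%N x - lambda ^+ n * V n (t n).
  elim: n => [|n IH]; first by rewrite /series /= big_geq // expr0 mul1r subrr.
  rewrite seriesSr IH -[tau_iter n a x]/(t n.+1) tE.
  by rewrite [V n _]VE exprSr; ring.
apply/cvg_lim => //; rewrite (funext partial) -[X in _ --> X]subr0.
apply: cvgB; first exact: cvg_cst.
apply: norm_cvg0.
apply: (@squeeze_cvgr _ _ _ _ (fun=> 0) (fun n => lambda ^+ n * M)).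
- apply: nearW => n; rewrite normr_ge0 normrM.
  rewrite ger0_norm ?exprn_ge0 ?(ltW hl0) //.
  by rewrite ler_wpM2l ?exprn_ge0 ?(ltW hl0) ?VM.
- exact: cvg_cst.
- rewrite -[X in _ --> X](mul0r M); apply: cvgMr_tmp.
  by apply: cvg_expr; rewrite ger0_norm // ltW.
Qed.

(** The index is the first symbol of the alternating sequence. The constant term c is forced by the
    identity for [branch true] at 0: as [potential (1 / 2)] vanishes, c is [lambda] times the value
    at 1/2. *)
Definition branch (i : bool) x : R :=
  let y := if i then x else 1 - x in
  (2 * lambda - lambda ^+ 2) / (4 * (4 - lambda) * (2 + lambda) * (lambda - 1))
  + lambda * y / ((2 + lambda) * (4 - lambda)) - y ^+ 2 / (4 - lambda).

Let denominators : [/\ 4 - lambda != 0, 2 + lambda != 0 & lambda - 1 != 0].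
Proof. by move: hl0 hl1 => l0 l1; split; apply/eqP => ?; lra. Qed.

Lemma branchE (i : bool) x :
  branch i x = potential (tau i x) + lambda * branch (~~ i) (tau i x).
Proof.
have [d1 d2 d3] := denominators.
by case: i; rewrite /branch /potential /tau /=; field; rewrite d1 d2 d3.
Qed.

Lemma branch_flip (i : bool) x : branch (~~ i) (1 - x) = branch i x.
Proof. by case: i; rewrite /branch //= subKr. Qed.

Lemma branch_bounded : exists M, forall i x, 0 <= x <= 1 -> `|branch i x| <= M.
Proof.
rewrite /branch; set c := _ / (_ * (lambda - 1)).
(* The sum of the absolute values of the coefficients suffices, because [y] stays in [0, 1]. *)
exists (`|c| + `|lambda / ((2 + lambda) * (4 - lambda))| + `|(4 - lambda)^-1|).
move=> i x /andP[x0 x1] /=; set y := if i then _ else _.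
have y01 : `|y| <= 1 by rewrite /y ler_norml; case: (i); apply/andP; split; lra.
rewrite (le_trans (ler_normB _ _)) // lerD //; last first.
  by rewrite normrM ler_piMl // normrX exprn_ile1.
rewrite (le_trans (ler_normD _ _)) // lerD //.
by rewrite mulrAC normrM ler_piMr.
Qed.

(** Each shift of an alternating sequence flips its first symbol, so [branchE] is the recursion
    needed for telescoping. The values true and false of [i] give [seq10] and [seq01]. *)
Lemma Ssum_alternating (i : bool) x : 0 <= x <= 1 ->
  Ssum lambda x (fun n => i (+) odd n) = branch i x.
Proof.
move=> x01; have [M bM] := branch_bounded.
rewrite (@Ssum_telescope _ (fun n => branch (i (+) odd n)) M) /= ?addbF //.
- by move=> n y; rewrite addbN; exact: branchE.
- by move=> n y; exact: bM.
Qed.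

(** * Comparison of the two quadratics and their maximum *)

Lemma branch_sub x :
  branch true x - branch false x =
  2 * (1 - 2 * x) / ((2 + lambda) * (4 - lambda)).
Proof.
have [d1 d2 d3] := denominators.
by rewrite /branch; field; rewrite d1 d2 d3.
Qed.

Lemma branch_le x : (branch false x <= branch true x) = (x <= 1 / 2).
Proof.
rewrite -subr_ge0 branch_sub pmulr_lge0; first by apply/idP/idP; lra.
by rewrite invr_gt0; move: hl0 hl1 => l0 l1; apply: mulr_gt0; lra.
Qed.

(** Written as a maximum rather than by cases, so that continuity at 1/2 needs no gluing. *)
Definition subaction x : R := Num.max (branch false x) (branch true x).

Lemma subaction_left x : x <= 1 / 2 -> subaction x = branch true x.
Proof. by rewrite -branch_le => /max_idPr. Qed.

(** The reflection of [x] to [1 - x] exchanges the two branches and preserves their maximum, which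
    reduces the claim to the left half. *)
Lemma subaction_right x : 1 / 2 <= x -> subaction x = branch false x.
Proof.
move=> hx; rewrite -[RHS](branch_flip false) -subaction_left; last by lra.
by rewrite /subaction -[branch true x]branch_flip -[branch false x]branch_flip
  maxC.
Qed.

Lemma subaction01 : subaction 0 = subaction 1.
Proof.
rewrite subaction_left ?subaction_right; [|lra..].
by rewrite -(branch_flip true) subr0.
Qed.

Lemma subaction_continuous : continuous subaction.
Proof.
have cb i : continuous (branch i).
  have cy : continuous (fun x : R => if i then x else 1 - x).
    move=> x; case: i; first exact: cvg_id.
    by apply: cvgB; [exact: cvg_cst | exact: cvg_id].
  move=> x; rewrite /branch /=; apply: cvgB.
    apply: cvgD; first exact: cvg_cst.
    by apply: cvgMr_tmp; apply: cvgMl_tmp; exact: cy.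
  apply: cvgMr_tmp; rewrite expr2.
  by under eq_fun do rewrite expr2; apply: cvgM; exact: cy.
by move=> x; apply: continuous_max; exact: cb.
Qed.

(** The point [tau false x] lies in the left half and [tau true x] in the right half, so at
    [tau i x] the maximum is [branch (~~ i)], exactly the term that [branchE] requires. *)
Lemma subactionE x : 0 <= x <= 1 ->
  subaction x =
  Num.max (lambda * subaction (tau false x) + potential (tau false x))
          (lambda * subaction (tau true x) + potential (tau true x)).
Proof.
move=> /andP[x0 x1].
rewrite (@subaction_left (tau false x)); last by rewrite /tau /=; lra.
rewrite (@subaction_right (tau true x)); last by rewrite /tau /=; lra.
by rewrite ![lambda * _ + _]addrC -(branchE false) -(branchE true).
Qed.

(** * Descent to the circle and the calibration equation *)

Lemma subaction_lift x : 0 <= x <= 1 ->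
  circ_lift subaction (circ x) = subaction x.
Proof.
by move=> /andP[x0 x1]; rewrite circ_lift_circ //; exact: subaction01.
Qed.

Lemma candidate_subaction : is_candidate lambda (circ_lift subaction).
Proof.
split=> x /andP[x0 x1]; have x01 : 0 <= x <= 1 by apply/andP; split; lra.
- by rewrite subaction_lift // subaction_left // -Ssum_alternating.
- by rewrite subaction_lift // subaction_right // -Ssum_alternating.
Qed.

(** The two halves cover the circle. This transfers everything proved for the lift of [subaction] to
    an arbitrary candidate. *)
Lemma candidate_unique (b1 b2 : circle R -> R) :
  is_candidate lambda b1 -> is_candidate lambda b2 -> b1 = b2.
Proof.
move=> [l1 r1] [l2 r2]; apply/funext => q.
have [x /andP[x0 /ltW x1] ->] := circP q.
have [hx|/ltW hx] := leP x (1 / 2); first by rewrite l1 ?l2 ?x0.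
by rewrite r1 ?r2 ?hx.
Qed.

(** The potential equals -1/4 at both endpoints, hence descends to the circle. *)
Lemma potential_lift x : 0 <= x <= 1 ->
  circ_lift (@potential R) (circ x) = potential x.
Proof.
by move=> /andP[x0 x1]; rewrite circ_lift_circ // /potential; field.
Qed.

Lemma calibrated_subaction_lift :
  calibrated_subaction lambda (circ_lift (@potential R)) (circ_lift subaction).
Proof.
split.
  apply: circ_lift_continuous; first exact: subaction01.
  exact: subaction_continuous.
move=> q; have [x x01 ->] := circP q; rewrite doubling_preimage //.
have {}x01 : 0 <= x <= 1 by case/andP: x01 => -> /ltW.
have tE i : lambda * circ_lift subaction (circ (tau i x)) +
    circ_lift (@potential R) (circ (tau i x)) =
    lambda * subaction (tau i x) + potential (tau i x).
  by rewrite potential_lift ?subaction_lift ?tau_itv.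
(* The fibre consists of the two branch points, so its maximum is the binary one: the larger term
   attains it, and each term is bounded by it. *)
rewrite subaction_lift // subactionE //; split=> [/=|_ /= [p [] -> <-]].
- have [_|_] := leP.
  + by exists (circ (tau true x)); [right|exact: tE].
  + by exists (circ (tau false x)); [left|exact: tE].
- by rewrite tE le_max lexx.
- by rewrite tE le_max lexx orbT.
Qed.

End Discounted.

(* The numerator of b(0) is 2 lambda - lambda^2, not the 2 lambda of the
   source, which is wrong for every 0 < lambda < 1. *)
Theorem proposition3 (R : realType) (lambda : R) (hl0 : 0 < lambda)
    (hl1 : lambda < 1) :
  (exists! b : circle R -> R, is_candidate lambda b) /\
  (forall b : circle R -> R, is_candidate lambda b ->
    [/\ calibrated_subaction lambda (circ_lift (@potential R)) b,
        forall x : R, 0 <= x <= 1 ->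
          b (circ x) =
            Num.max (lambda * b (circ (tau false x)) + potential (tau false x))
                    (lambda * b (circ (tau true x)) + potential (tau true x)) /\
          b (circ x) =
            Num.max (lambda * b (circ (x / 2)) + potential (x / 2))
                    (lambda * b (circ (x / 2 + 1 / 2)) +
                     potential (x / 2 + 1 / 2)),
        b (circ 0) = (2 * lambda - lambda ^+ 2) /
                     (4 * (4 - lambda) * (2 + lambda) * (lambda - 1)),
        forall x : R, 0 <= x <= 1 / 2 ->
          b (circ x) = b (circ 0) + lambda * x / ((2 + lambda) * (4 - lambda))
                       - x ^+ 2 / (4 - lambda) &
        forall x : R, 1 / 2 <= x <= 1 ->
          b (circ x) = b (circ 0)
                       + lambda * (1 - x) / ((2 + lambda) * (4 - lambda))
                       - (1 - x) ^+ 2 / (4 - lambda)]).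
Proof.
have cand := candidate_subaction hl0 hl1.
split=> [|b /(candidate_unique cand) <-].
  exists (circ_lift (subaction lambda)); split=> // b.
  exact: candidate_unique.
have E x : 0 <= x <= 1 ->
    circ_lift (subaction lambda) (circ x) = subaction lambda x.
  exact: subaction_lift.
have b0 : circ_lift (subaction lambda) (circ 0) =
    (2 * lambda - lambda ^+ 2) /
    (4 * (4 - lambda) * (2 + lambda) * (lambda - 1)).
  rewrite E ?lexx ?ler01 // subaction_left ?divr_ge0 //.
  by rewrite /branch mulr0 expr0n !mul0r addr0 subr0.
split=> //.
- exact: calibrated_subaction_lift.
(* Merging [x / 2 + 1 / 2] into [(x + 1) / 2] makes both displayed forms the same equation. *)
- move=> x x01; rewrite -mulrDl.
  have -> : x / 2 = tau false x by rewrite /tau addr0.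
  have -> : (x + 1) / 2 = tau true x by [].
  by rewrite !E ?tau_itv // -subactionE.
- move=> x /andP[x0 x1]; rewrite b0 E; last by apply/andP; split; lra.
  by rewrite subaction_left.
- move=> x /andP[x0 x1]; rewrite b0 E; last by apply/andP; split; lra.
  by rewrite subaction_right.
Qed.
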